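(* Let $\mathcal{G}$ and $\mathcal{H}$ be ultragraphs without sinks, with associated ultragraph shift spaces $X_{\mathcal{G}}$ and $X_{\mathcal{H}}$, and let $\Phi:X_{\mathcal{G}}\to X_{\mathcal{H}}$ be a map. If $\Phi$ is continuous and shift commuting, then $\Phi$ is given by $$\bigl(\Phi(x)\bigr)_n=\sum_{a\in \mathbf{A}_{\mathcal{H}}}a\,\mathbf{1}_{C_a}\circ\sigma^{n-1}(x)\quad\text{for all } x\in X_{\mathcal{G}},\ n\geq 1,$$ where: (i) $\{C_a\}_{a\in \mathbf{A}_{\mathcal{H}}}$ is a partition of $X_{\mathcal{G}}$ such that, for each $a\in \mathbf{A}_{\mathcal{H}}\setminus \mathfrak{p}^0_{\mathcal{H}\,min}$, the set $C_a$ is a (possibly empty) union of generalized cylinders of $X_{\mathcal{G}}$; (ii) if $\Phi(\alpha_1\ldots\alpha_k AA\ldots)=(\beta_1\ldots\beta_l BB\ldots)\in X_{\mathcal{H}}^{fin}$ for some $(\alpha_1\ldots\alpha_k AA\ldots)\in X_{\mathcal{G}}^{fin}$ (in which case necessarily $l\leq k$), where $k,l\ge 0$ are the lengths of these sequences, then for every neighbourhood of $(BB\ldots)$ of the form $D_{B,F}$, with $F\subseteq\varepsilon(B)$ finite, there exists a generalized cylinder $D_{(\sigma^{l}(\alpha_1\ldots\alpha_k),A),F'}$, with $F'\subseteq\varepsilon(A)$ finite, such that $\Phi\bigl(D_{(\sigma^{l}(\alpha_1\ldots\alpha_k),A),F'}\bigr)\subseteq D_{B,F}$; here $\sigma^l(\alpha_1\ldots\alpha_k)=\alpha_{l+1}\ldots\alpha_k$,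 and $D_{(\sigma^{l}(\alpha_1\ldots\alpha_k),A),F'}$ means $D_{A,F'}$ when $l=k$; (iii) if $(AA\ldots)\in X_{\mathcal{G}}^0$ is such that $|\Phi(AA\ldots)|>0$, say $\Phi(AA\ldots)=(ddd\ldots)$, then for all integers $M>0$ there exists a generalized cylinder $D_{A,F}$, with $F\subseteq\varepsilon(A)$ finite, such that $\sigma^i(D_{A,F})\subseteq C_d$ for all $i=0,1,\ldots,M$. Under the additional hypothesis that $\Phi$ is continuous on $X^{inf}_{\mathcal{G}}\cap\Phi^{-1}(X^0_{\mathcal{H}})$, the converse also holds: if $\Phi$ is given by the displayed formula for a family $\{C_a\}_{a\in\mathbf{A}_{\mathcal{H}}}$ such that (i), (ii) and (iii) hold, then $\Phi$ is continuous and shift commuting.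
   Context: An ultragraph is a quadruple $\mathcal{G}=(G^0,\mathcal{G}^1,r,s)$ with a set of vertices $G^0$, a set of edges $\mathcal{G}^1$, a source map $s:\mathcal{G}^1\to G^0$ and a range map $r:\mathcal{G}^1\to P(G^0)\setminus\{\emptyset\}$. It has no sinks if every vertex $v$ satisfies $s^{-1}(v)\neq\emptyset$. $\mathcal{G}^0$ is the smallest subset of $P(G^0)$ containing all $\{v\}$ ($v\in G^0$) and all $r(e)$ ($e\in\mathcal{G}^1$), closed under finite unions and under non-empty finite intersections. For $A\subseteq G^0$, $\varepsilon(A)=\{e\in\mathcal{G}^1: s(e)\in A\}$. $A\in\mathcal{G}^0$ is an infinite emitter if $\varepsilon(A)$ is infinite, and a minimal infinite emitter if moreover no proper subset of $A$ belonging to $\mathcal{G}^0$ is an infinite emitter. $\mathfrak{p}^0_{\mathcal{G}\,min}$ denotes the set of minimal infinite emitters. A finite path of length $n\geq1$ is $\alpha=\alpha_1\ldots\alpha_n$ with $\alpha_i\in\mathcal{G}^1$ and $s(\alpha_{i+1})\in r(\alpha_i)$ for $1\le i<n$; $r(\alpha)=r(\alpha_n)$. The ultrapath space $\mathfrak{p}_{\mathcal{G}}$ consists of the elements $A\in\mathcal{G}^0$ (length $0$, $r(A)=A$) and the pairs $(\alpha,A)$ with $\alpha$ a finite path of length $n\ge1$ and $A\in\mathcal{G}^0$, $A\subseteq r(\alpha)$ (length $n$, $r((\alpha,A))=A$). $X_{\mathcal{G}}^{inf}$ is the set of infinite paths $(\gamma_i)_{i\ge1}$, $\gamma_i\in\mathcal{G}^1$,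 $s(\gamma_{i+1})\in r(\gamma_i)$ (length $\infty$). $X_{\mathcal{G}}^{fin}$ is the set of sequences $(\alpha_1\ldots\alpha_kAAA\ldots)$, $k\geq 0$, where $A$ is a minimal infinite emitter and, if $k\ge1$, $\alpha_1\ldots\alpha_k$ is a finite path with $A\subseteq r(\alpha_k)$; such a sequence has length $k$. $X_{\mathcal{G}}^0$ is the set of length-$0$ sequences $(AAA\ldots)$. The shift space is $X_{\mathcal{G}}=X_{\mathcal{G}}^{fin}\cup X_{\mathcal{G}}^{inf}$, with shift map $\sigma((x_i)_{i\ge1})=(x_{i+1})_{i\ge1}$; $|x|$ denotes the length of $x$. The alphabet is $\mathbf{A}_{\mathcal{G}}=\mathcal{G}^1\cup\mathfrak{p}^0_{\mathcal{G}\,min}$. The same notation is used for $\mathcal{H}$. An ultrapath $A\in\mathcal{G}^0$ is a prefix of $x\in X_{\mathcal{G}}$ if either $x_1\in\mathcal{G}^1$ and $s(x_1)\in A$, or $x_1$ is a minimal infinite emitter contained in $A$. An ultrapath $(\gamma_1\ldots\gamma_n,A)$ is a prefix of $x$ if $x_i=\gamma_i$ for $1\le i\le n$ and $A$ is a prefix of $\sigma^n(x)$. The topology on $X_{\mathcal{G}}$ is generated by the generalized cylinders (also called cylinders) $D_{\mathbf{y},F}=\{x\in X_{\mathcal{G}}:\mathbf{y}\text{ is a prefix of }x\text{ and }x_{|\mathbf{y}|+1}\notin F\}$, with $\mathbf{y}\in\mathfrak{p}_{\mathcal{G}}$ and $F$ a finite (possibly empty) subset of $\varepsilon(r(\mathbf{y}))$;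 $D_{\mathbf{y}}=D_{\mathbf{y},\emptyset}$. ($\sigma$ need not be continuous at points of length zero.) A map $\Phi:X_{\mathcal{G}}\to X_{\mathcal{H}}$ is shift commuting if $\Phi\circ\sigma=\sigma\circ\Phi$. ''Continuous on a set $S$'' means continuous at every point of $S$ (as a map on $X_{\mathcal{G}}$). A partition is a family of pairwise disjoint (possibly empty) sets with union the whole space. The sum $\sum_a a\mathbf{1}_{C_a}$ is symbolic: $(\Phi(x))_n=a$ for the unique $a\in\mathbf{A}_{\mathcal{H}}$ with $\sigma^{n-1}(x)\in C_a$. *)

(* Defs.v *)
From HB Require Import structures.
From mathcomp Require Import all_boot all_order.
From mathcomp Require Import boolp classical_sets functions cardinality filter.
From mathcomp Require Import topology.

Set Implicit Arguments.
Unset Strict Implicit.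
Unset Printing Implicit Defensive.

Local Open Scope classical_set_scope.

Record ultragraph := Ultragraph {
  vertex : Type;
  edge : Type;
  src : edge -> vertex;
  rng : edge -> set vertex;
  rng_neq0 : forall e, rng e !=set0 }.

Definition no_sinks (G : ultragraph) :=
  forall v : vertex G, src (u := G) @^-1` [set v] !=set0.

(* The family G^0; only non-empty intersections are required, so the empty set
   is not a member. *)
Inductive gvset (G : ultragraph) : set (vertex G) -> Prop :=
| gvset_vertex v : gvset [set v]
| gvset_rng e : gvset (rng e)
| gvsetU A B : gvset A -> gvset B -> gvset (A `|` B)
| gvsetI A B : gvset A -> gvset B -> A `&` B !=set0 -> gvset (A `&` B).

Definition emitted (G : ultragraph) (A : set (vertex G)) : set (edge G) :=
  src (u := G) @^-1` A.

Definition infinite_emitter (G : ultragraph) (A : set (vertex G)) :=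
  gvset A /\ infinite_set (emitted A).

Definition minimal_infinite_emitter (G : ultragraph) (A : set (vertex G)) :=
  infinite_emitter A /\
  forall B, gvset B -> B `<` A -> ~ infinite_emitter B.

Definition min_emitter (G : ultragraph) :=
  {A : set (vertex G) | minimal_infinite_emitter A}.

Definition letter (G : ultragraph) : Type := (edge G + min_emitter G)%type.

Definition follows (G : ultragraph) : rel (edge G) :=
  fun e f => src f \in rng e.

(* The empty path stands for "no path": it imposes no range constraint, so
   that ([::], A) below encodes the length-0 ultrapath A. *)
Definition path_range (G : ultragraph) (alpha : seq (edge G)) :
    set (vertex G) :=
  if alpha is e :: alpha' then rng (last e alpha') else setT.

Definition ultrapath (G : ultragraph) (alpha : seq (edge G))
    (A : set (vertex G)) :=
  [/\ sorted (@follows G) alpha, gvset A & A `<=` path_range alpha].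

Definition infinite_path (G : ultragraph) (x : nat -> letter G) :=
  exists2 gamma : nat -> edge G,
    (forall i, src (gamma i.+1) \in rng (gamma i)) & x = inl \o gamma.

(* alpha_1 ... alpha_k A A A ... *)
Definition finite_seq (G : ultragraph) (alpha : seq (edge G))
    (A : min_emitter G) : nat -> letter G :=
  nth (inr A) (map inl alpha).

Definition finite_path (G : ultragraph) (x : nat -> letter G) :=
  exists alpha A, ultrapath alpha (sval A) /\ x = finite_seq alpha A.

(* Sequences are indexed from 0: [x n] is the letter x_(n+1). *)
Record shift_space (G : ultragraph) := ShiftSpace {
  xseq :> nat -> letter G;
  xseqP : finite_path xseq \/ infinite_path xseq }.

Definition Xinf (G : ultragraph) : set (shift_space G) :=
  [set x | infinite_path x].

Definition X0 (G : ultragraph) : set (shift_space G) :=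
  [set x | exists A : min_emitter G, xseq x = finite_seq [::] A].

Lemma shift_subproof (G : ultragraph) (x : shift_space G) :
  finite_path (fun n => x n.+1) \/ infinite_path (fun n => x n.+1).
Proof.
case: (xseqP x) => [[alpha [A [[pa gA sA] ->]]]|[gamma gP ->]]; last first.
  by right; exists (fun n => gamma n.+1) => // i; exact: gP.
left; exists (behead alpha), A; split.
  case: alpha pa sA => [|e [|f alpha]] //= pa sA; split=> //.
  by case/andP: pa.
by apply/funext => n; case: alpha {pa sA} => [|e alpha] //=; rewrite /finite_seq /= nth_nil.
Qed.

Definition shift_map (G : ultragraph) (x : shift_space G) : shift_space G :=
  ShiftSpace (shift_subproof x).

Definition set_prefix (G : ultragraph) (A : set (vertex G))
    (x : shift_space G) : Prop :=
  match x 0%N with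
  | inl e => A (src e)
  | inr B => sval B `<=` A
  end.

Definition ultrapath_prefix (G : ultragraph) (alpha : seq (edge G))
    (A : set (vertex G)) (x : shift_space G) : Prop :=
  mkseq x (size alpha) = map inl alpha /\
  set_prefix A (iter (size alpha) (@shift_map G) x).

Definition cylinder (G : ultragraph) (alpha : seq (edge G))
    (A : set (vertex G)) (F : set (edge G)) : set (shift_space G) :=
  [set x | ultrapath_prefix alpha A x /\
           ~ (inl @` F : set (letter G)) (x (size alpha))].

Definition finite_emitted (G : ultragraph) (A : set (vertex G))
    (F : set (edge G)) :=
  finite_set F /\ F `<=` emitted A.

Definition gen_cylinders (G : ultragraph) : set (set (shift_space G)) :=
  [set U | exists alpha A F,
    [/\ ultrapath alpha A, finite_emitted A F & U = cylinder alpha A F]].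

HB.instance Definition _ (G : ultragraph) := gen_eqMixin (shift_space G).
HB.instance Definition _ (G : ultragraph) := gen_choiceMixin (shift_space G).
HB.instance Definition _ (G : ultragraph) :=
  isSubBaseTopological.Build (shift_space G) (@gen_cylinders G) id.

Definition shift_commuting (G H : ultragraph)
    (Phi : shift_space G -> shift_space H) :=
  Phi \o @shift_map G = @shift_map H \o Phi.

Definition union_of_cylinders (G : ultragraph) (U : set (shift_space G)) :=
  exists2 K, K `<=` @gen_cylinders G & U = \bigcup_(V in K) V.

(* Phi(x)_(n+1) is the unique letter a with sigma^n(x) in C_a. *)
Definition block_formula (G H : ultragraph)
    (Phi : shift_space G -> shift_space H)
    (C : letter H -> set (shift_space G)) :=
  forall x n a, Phi x n = a <-> C a (iter n (@shift_map G) x).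

Definition cylinder_partition (G H : ultragraph)
    (C : letter H -> set (shift_space G)) :=
  [/\ trivIset setT C, \bigcup_a C a = setT &
      forall e : edge H, union_of_cylinders (C (inl e))].

Definition length_nonincreasing (G H : ultragraph)
    (Phi : shift_space G -> shift_space H) :=
  forall x alpha A beta B,
    xseq x = finite_seq alpha A -> xseq (Phi x) = finite_seq beta B ->
    (size beta <= size alpha)%N.

(* [drop (size beta) alpha] is sigma^l(alpha), which is empty when l = k. *)
Definition finite_to_finite (G H : ultragraph)
    (Phi : shift_space G -> shift_space H) :=
  forall x alpha A beta B,
    xseq x = finite_seq alpha A -> xseq (Phi x) = finite_seq beta B ->
    forall F, finite_emitted (sval B) F ->
    exists2 F', finite_emitted (sval A) F' &
      Phi @` cylinder (drop (size beta) alpha) (sval A) F'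
        `<=` cylinder [::] (sval B) F.

(* Positive, possibly infinite, length is being outside [X0]. *)
Definition zero_to_positive (G H : ultragraph)
    (Phi : shift_space G -> shift_space H)
    (C : letter H -> set (shift_space G)) :=
  forall x A, xseq x = finite_seq [::] A -> ~ X0 (Phi x) ->
  exists2 d, xseq (Phi x) = (fun=> d) &
    forall M, (0 < M)%N ->
    exists2 F, finite_emitted (sval A) F &
      forall i, (i <= M)%N ->
        iter i (@shift_map G) @` cylinder [::] (sval A) F `<=` C d.

(* Main.v *)
(* A finite point alpha A A ... has a neighbourhood basis of cylinders
   D_{(alpha, A), F}, and an infinite point one of cylinders fixing a prefix; so
   the n-th iterate of the shift is continuous at points of length at least n,
   and each set where a given coordinate is a given edge is open.  A shift
   commuting map sends fixed points of the shift to fixed points, so it cannot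
   increase lengths, and with C_a = {x | Phi(x)_1 = a} the direct implication is
   continuity read at the iterates of x.  Conversely, continuity at x is tested
   on the letters of Phi(x).  If Phi(x) has finite length l, its first l letters
   are locally constant by (i), and l shifts reduce the rest to a point whose
   image has length zero, where (ii) or the extra hypothesis applies.  If Phi(x)
   is infinite but x has finite length k, (i) handles only the first letters;
   after k shifts (iii) makes any number of later letters locally constant. *)
Require Import Defs.
From mathcomp Require Import all_boot all_order.
From mathcomp Require Import boolp classical_sets functions cardinality filter.
From mathcomp Require Import topology.
From mathcomp Require Import finmap.
(* The library [cardinality] shadows [finite_seq]. *)
Import Defs.
Local Open Scope classical_set_scope.

Set Implicit Arguments.
Unset Strict Implicit.
Unset Printing Implicit Defensive.

(** * Sequences, their shifts and their edge prefixes *)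

Section ShiftSpace.
Context {G : ultragraph}.
Implicit Types (x y : shift_space G) (alpha : seq (edge G)) (A : min_emitter G).
Local Notation shift := (@shift_map G).

Lemma shift_space_ext x y : xseq x = xseq y -> x = y.
Proof.
case: x y => [x xP] [y yP] /= exy; rewrite exy in xP *.
by rewrite (Prop_irrelevance xP yP).
Qed.

Lemma iter_shiftE n x m : iter n shift x m = x (n + m).
Proof. by elim: n m => [|n IHn] m //=; rewrite IHn addnS. Qed.

Lemma finite_seq_nil A n : finite_seq [::] A n = inr A.
Proof. by rewrite /finite_seq nth_nil. Qed.

Lemma finite_seqD alpha A n m :
  finite_seq alpha A (n + m) = finite_seq (drop n alpha) A m.
Proof. by rewrite /finite_seq map_drop nth_drop. Qed.

Lemma finite_seq_oversize alpha A n :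
  size alpha <= n -> finite_seq alpha A n = inr A.
Proof. by move=> le_n; rewrite /finite_seq nth_default ?size_map. Qed.

Lemma is_inl_finite_seq alpha A n :
  is_inl (finite_seq alpha A n) = (n < size alpha).
Proof.
by elim: alpha n => [|e alpha IHalpha] [|n] //=; apply: IHalpha.
Qed.

Lemma mkseq_finite_seq alpha A :
  mkseq (finite_seq alpha A) (size alpha) = map inl alpha.
Proof. by rewrite -(size_map (@inl _ (min_emitter G))) mkseq_nth. Qed.

Lemma finite_seq_inj alpha beta A B :
  finite_seq alpha A = finite_seq beta B -> alpha = beta /\ A = B.
Proof.
elim: alpha beta => [|e alpha IHalpha] [|f beta] eq_ab.
- by have := congr1 (fun z => z 0) eq_ab => -[].
- by have := congr1 (fun z => z 0) eq_ab.
- by have := congr1 (fun z => z 0) eq_ab.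
have [<-] := congr1 (fun z => z 0) eq_ab.
by have [<- <-] := IHalpha _ (congr1 (fun z n => z n.+1) eq_ab).
Qed.

(** A finite sequence determines its path and its emitter, and an infinite path contains no emitter
    letter, so the admissibility proof carried by [x] concerns this very pair. *)
Lemma finite_seqP x alpha A :
  xseq x = finite_seq alpha A -> ultrapath alpha (sval A).
Proof.
move=> ex; case: (xseqP x) => [[beta [B [uB]]]|[gamma _]].
  by rewrite ex => /finite_seq_inj[-> ->].
rewrite ex => /(congr1 (fun z => z (size alpha))).
by rewrite finite_seq_oversize.
Qed.

Lemma iter_shift_finite j x alpha A : xseq x = finite_seq alpha A ->
  xseq (iter j shift x) = finite_seq (drop j alpha) A.
Proof. by move=> ex; apply/funext => n; rewrite iter_shiftE ex finite_seqD. Qed.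

Lemma set_prefix_rng x e : x 0 = inl e -> set_prefix (rng e) (shift x).
Proof.
rewrite /set_prefix /=.
case: (xseqP x) => [[alpha [A [[pa _ sA] ->]]]|[gamma gP ->]].
  case: alpha pa sA => [|f [|g alpha]] //= pa sA [<-].
    exact: sA.
  by case/andP: pa => /set_mem.
by move=> [<-]; apply/set_mem/gP.
Qed.

Lemma edge_prefix x n : (forall i, i < n -> is_inl (x i)) ->
  exists alpha, [/\ size alpha = n, sorted (@follows G) alpha &
    mkseq x n = map inl alpha].
Proof.
case: (xseqP x) => [[alpha [A [[pa _ _] ex]]]|[gamma gP ex]] xn.
  exists (take n alpha).
  have le_n : n <= size alpha.
    case: n xn => // n xn.
    by have := xn n (ltnSn n); rewrite ex is_inl_finite_seq.
  rewrite size_takel //; split=> //.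
    by move: pa; rewrite -{1}(cat_take_drop n alpha) => /cat_sorted2[].
  rewrite map_take -(mkseq_finite_seq alpha A) -ex.
  by rewrite /mkseq -map_take take_iota (minn_idPl le_n).
exists (mkseq gamma n); rewrite size_mkseq; split=> //.
  case: n {xn} => // n; rewrite /mkseq /=.
  elim: n 0 => //= n IHn i; rewrite IHn andbT; exact: gP.
by rewrite ex /mkseq -map_comp.
Qed.

(** * Neighbourhood bases at finite and infinite points *)

Lemma cylinder_nbhs x U : gen_cylinders U -> U x -> nbhs x U.
Proof.
move=> gU Ux; exists U; split=> //; exists [set U]; last first.
  by rewrite bigcup_set1.
move=> _ ->; exists [fset U]%fset; last by rewrite set_fset1 bigcap_set1.
by move=> V /=; rewrite inE => /eqP ->; exact: mem_set.
Qed.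

(** Cylinders are given only as a subbase; stability of filters under finite intersections makes
    them enough to test convergence. *)
Lemma cylinder_cvg x (F : set_system (shift_space G)) : Filter F ->
  (forall U, gen_cylinders U -> U x -> F U) -> F --> x.
Proof.
move=> FF FU V [_ [[B sB <-] [C BC Cx] sV]].
apply: (@filterS _ F _ C); first by move=> y Cy; apply: sV; exists C.
have [D sD eC] := sB _ BC; rewrite -eC; apply: filter_bigI => U DU.
apply: FU; first exact/set_mem/sD.
by move: Cx; rewrite -eC; apply.
Qed.

Lemma cylinderE alpha (A F : set _) y :
  cylinder alpha A F y <-> mkseq y (size alpha) = map inl alpha /\
    cylinder [::] A F (iter (size alpha) shift y).
Proof.
rewrite /cylinder /= /ultrapath_prefix /= iter_shiftE addn0.
by split=> [[[]]|[? [[]]]].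
Qed.

Lemma cylinder_finite_seq x alpha A F :
  xseq x = finite_seq alpha A -> cylinder alpha (sval A) F x.
Proof.
move=> ex; split; first split.
- by rewrite ex mkseq_finite_seq.
- by rewrite /set_prefix iter_shiftE ex finite_seq_oversize ?addn0.
- by rewrite ex finite_seq_oversize // => -[].
Qed.

Lemma cylinder_drop j alpha (A F : set _) y : j <= size alpha ->
  cylinder alpha A F y -> cylinder (drop j alpha) A F (iter j shift y).
Proof.
move=> lej /cylinderE[ey Ay]; apply/cylinderE; split.
  rewrite size_drop map_drop -ey /mkseq -map_drop.
  rewrite drop_iota addnC iotaDl -map_comp.
  by apply: eq_map => i; rewrite /= iter_shiftE.
by rewrite -iterD size_drop subnK.
Qed.

Lemma mkseq_inl_eq x y alpha n : size alpha = n ->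
  mkseq y n = map inl alpha -> mkseq x n = map inl alpha ->
  forall i, i < n -> y i = x i.
Proof.
move=> sa ey ex i ltin.
by rewrite -(nth_mkseq (x 0) y ltin) -(nth_mkseq (x 0) x ltin) ey ex.
Qed.

Lemma prefix_cylinder x n : (forall i, i < n.+1 -> is_inl (x i)) ->
  exists V, [/\ gen_cylinders V, V x &
    V `<=` [set y | forall i, i < n.+1 -> y i = x i]].
Proof.
move=> xn; have [alpha [sa pa ea]] := edge_prefix xn.
case: alpha sa pa ea => // e alpha sa pa ea.
(* Taking the whole range of the last edge puts no condition on the letters after the prefix. A last
   edge exists because the prefix length [n.+1] is positive. *)
exists (cylinder (e :: alpha) (rng (last e alpha)) set0); split.
- exists (e :: alpha), (rng (last e alpha)), set0; split=> //.
    by split=> //; exact: gvset_rng.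
  by split=> //; exact: finite_set0.
- split; last by move=> [].
  split; first by rewrite sa.
  rewrite sa iterS; apply: set_prefix_rng; rewrite iter_shiftE addn0.
  rewrite -(nth_mkseq (x 0) x (ltnSn n)) ea (nth_map e) ?sa //.
  by congr inl; rewrite -[n]/(n.+1.-1) -sa nth_last.
- by move=> y [[]]; rewrite sa => ey _ _ i; exact: mkseq_inl_eq sa ey ea i.
Qed.

Lemma nbhs_prefix x n : (forall i, i < n -> is_inl (x i)) ->
  nbhs x [set y | forall i, i < n -> y i = x i].
Proof.
case: n => [|n] xn; first by apply: filterS filterT.
have [V [gV Vx sV]] := prefix_cylinder xn.
exact: filterS sV (cylinder_nbhs gV Vx).
Qed.

Lemma nbhs_infinite x U : (forall i, is_inl (x i)) -> nbhs x U ->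
  exists n, forall y, (forall i, i < n -> y i = x i) -> U y.
Proof.
move=> xE.
pose B n := [set y : shift_space G | forall i, i < n -> y i = x i].
have FB : Filter (filter_from setT B).
  apply: filter_fromT_filter; first by exists 0.
  move=> i j; exists (maxn i j) => y Bijy.
  by split=> k ltk; apply: Bijy; rewrite leq_max ltk ?orbT.
suff /(_ U) cvB : filter_from setT B --> x by move=> /cvB[n _ BU]; exists n.
apply: cylinder_cvg => _ [alpha [A [F [[_ gA sA] _ ->]]]] [[pax Ax] nFx].
(* One letter beyond [alpha] is fixed as well: both the set [A] and the exclusions [F] constrain
   that letter. *)
exists (size alpha).+1 => // y Bxy; split; first split.
- rewrite -pax; apply/eq_in_map => i; rewrite mem_iota => /= ltis.
  by apply: Bxy; rewrite ltnS ltnW.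
- by move: Ax; rewrite /set_prefix !iter_shiftE addn0 (Bxy (size alpha)).
- by rewrite Bxy.
Qed.

Lemma nbhs_finite x alpha A U : xseq x = finite_seq alpha A -> nbhs x U ->
  exists2 F, finite_emitted (sval A) F & cylinder alpha (sval A) F `<=` U.
Proof.
move=> ex.
pose B := cylinder alpha (sval A).
have FB : Filter (filter_from (finite_emitted (sval A)) B).
  apply: filter_from_filter.
    by exists set0; split; [exact: finite_set0|].
  move=> F1 F2 [fF1 sF1] [fF2 sF2]; exists (F1 `|` F2).
    by split; [rewrite finite_setU|move=> e [/sF1|/sF2]].
  move=> y [Ay nFy]; split; split=> // -[e Fe ey]; apply: nFy; exists e => //.
    by left.
  by right.
suff /(_ U) cvB : filter_from (finite_emitted (sval A)) B --> x by [].
apply: cylinder_cvg => _ [beta [C [F [[_ gC sC] [fF sF] ->]]]] [[pbx Cx] nFx].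
(* A longer [beta] would require an edge at a position where [x] already repeats [A]. *)
have leba : size beta <= size alpha.
  rewrite leqNgt; apply/negP => ltab.
  have := nth_mkseq (x 0) x ltab; rewrite pbx.
  rewrite {2}ex finite_seq_oversize //.
  by case: beta ltab {C F sC fF sF pbx Cx nFx gC} => // e b ltab;
    rewrite (nth_map e).
have pby y : B set0 y -> mkseq y (size beta) = map inl beta.
  move=> [[pay _] _]; rewrite -pbx; apply/eq_in_map => i.
  rewrite mem_iota => /= ltib; have ltia := leq_trans ltib leba.
  by apply: (mkseq_inl_eq (erefl _) pay) ltia; rewrite ex mkseq_finite_seq.
have Bset0 F' y : B F' y -> B set0 y by move=> [? _]; split=> // -[].
move: leba; rewrite leq_eqVlt => /predU1P[sba|ltba]; last first.
  (* Here the letter tested by [C] and [F] lies inside [alpha], so agreement with [alpha] suffices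
     and nothing has to be excluded. *)
  exists set0; first by split; [exact: finite_set0|].
  move=> y By; have [[pay _] _] := By.
  have yb : y (size beta) = x (size beta).
    by apply: (mkseq_inl_eq (erefl _) pay) ltba; rewrite ex mkseq_finite_seq.
  split; last by rewrite yb.
  split; first exact: pby.
  move: Cx; rewrite /set_prefix !iter_shiftE addn0 yb.
  have := is_inl_finite_seq alpha A (size beta); rewrite -ex ltba.
  by case: (x _).
(* Only edges emitted by [A] may be excluded. This loses nothing: if an edge follows [alpha] in a
   point of the cylinder, its source is in [A]. *)
exists (F `&` emitted (sval A)).
  by split; [exact: finite_setIl|move=> e []].
have AC : sval A `<=` C.
  move: Cx; rewrite /set_prefix iter_shiftE addn0 ex.
  by rewrite finite_seq_oversize ?sba.
move=> y By; have [[pay Ay] nFy] := By.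
split; first split.
- exact: pby (Bset0 _ _ By).
- move: Ay; rewrite sba /set_prefix; case: (xseq _ _) => [e|D].
    exact: AC.
  by move=> DA; apply: subset_trans AC.
- rewrite sba => -[e Fe ey]; apply: nFy; exists e => //; split=> //.
  by move: Ay; rewrite /set_prefix iter_shiftE addn0 -ey.
Qed.

Lemma finite_or_is_inl x : (exists alpha A, xseq x = finite_seq alpha A) \/
  (forall i, is_inl (x i)).
Proof.
case: (xseqP x) => [[alpha [A [_ ex]]]|[gamma _ ->]]; last by right.
by left; exists alpha, A.
Qed.

Lemma XinfP x : (forall i, is_inl (x i)) <-> Xinf x.
Proof.
split=> [xE|[gamma _ ex] i]; last by rewrite ex.
case: (xseqP x) => // -[alpha [A [_ ex]]].
by have := xE (size alpha); rewrite ex finite_seq_oversize.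
Qed.

(** The hypothesis bounds [j] by the length of [x]. At a finite point, dropping [j] letters then
    sends the cylinder of [(alpha, A)] and [F] into that of [(drop j alpha, A)] and [F]; at an
    infinite point, [j + n] letters control [n] letters of the shift. *)
Lemma iter_shift_cvg x j : (forall i, i < j -> is_inl (x i)) ->
  iter j shift @ x --> iter j shift x.
Proof.
move=> xj U; rewrite /fmap /=.
case: (finite_or_is_inl x) => [[alpha [A ex]]|xE].
  have leja : j <= size alpha.
    case: j xj => // j xj.
    by have := xj j (ltnSn j); rewrite ex is_inl_finite_seq.
  move=> /(nbhs_finite (iter_shift_finite j ex))[F fF FU].
  have gU : gen_cylinders (cylinder alpha (sval A) F).
    by exists alpha, (sval A), F; split=> //; exact: finite_seqP ex.
  apply: filterS (cylinder_nbhs gU (cylinder_finite_seq _ ex)) => y Fy.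
  by apply: FU; apply: cylinder_drop.
have xjE i : is_inl (iter j shift x i) by rewrite iter_shiftE.
move=> /(nbhs_infinite xjE)[n nU].
have /filterS := @nbhs_prefix x (j + n) (fun i _ => xE i); apply => y ey.
by apply: nU => i ltin; rewrite !iter_shiftE ey // ltn_add2l.
Qed.

Lemma nbhs_cylinder x U : nbhs x U ->
  exists V, [/\ gen_cylinders V, V x & V `<=` U].
Proof.
move=> Ux; case: (finite_or_is_inl x) => [[alpha [A ex]]|xE].
  have [F fF FU] := nbhs_finite ex Ux.
  exists (cylinder alpha (sval A) F); split=> //.
    by exists alpha, (sval A), F; split=> //; exact: finite_seqP ex.
  exact: cylinder_finite_seq.
have [n nU] := nbhs_infinite xE Ux.
(* This fixes [n.+1] letters, one more than needed, so that the prefix is nonempty even for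
   [n = 0]. *)
have [V [gV Vx sV]] := @prefix_cylinder x n (fun i _ => xE i).
exists V; split=> // y /sV ey; apply: nU => i ltin.
by apply: ey; rewrite ltnS ltnW.
Qed.

(** The right-hand side is openness; the equivalence holds because the cylinders form a base. *)
Lemma union_of_cylindersP U :
  union_of_cylinders U <-> forall x, U x -> nbhs x U.
Proof.
split=> [[K gK ->] x [V KV Vx]|nU].
  apply: filterS (cylinder_nbhs (gK V KV) Vx) => y Vy.
  by exists V.
exists [set V | gen_cylinders V /\ V `<=` U]; first by move=> V [].
apply/seteqP; split=> [x Ux|x [V [_ VU] Vx]]; last exact: VU.
have [V [gV Vx VU]] := nbhs_cylinder (nU x Ux).
by exists V.
Qed.

(** * Fixed points of the shift *)

Lemma shift_map_zero x A : xseq x = finite_seq [::] A -> shift x = x.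
Proof.
move=> ex; apply: shift_space_ext; apply/funext => n.
by rewrite /= ex !finite_seq_nil.
Qed.

Lemma iter_shift_size x alpha A : xseq x = finite_seq alpha A ->
  xseq (iter (size alpha) shift x) = finite_seq [::] A.
Proof. by move/(iter_shift_finite (size alpha)); rewrite drop_size. Qed.

Lemma shift_map_fixed x : shift x = x -> xseq x = (fun=> x 0).
Proof.
move=> fx; apply/funext; elim=> // n <-.
by rewrite -[in RHS]fx.
Qed.

End ShiftSpace.

(** * Shift commuting maps and the direct implication *)

Section ShiftCommuting.
Context {G H : ultragraph} {Phi : shift_space G -> shift_space H}.
Hypothesis Phi_shift : shift_commuting Phi.

Lemma shift_commuting_iter n x :
  Phi (iter n (@shift_map G) x) = iter n (@shift_map H) (Phi x).
Proof.
elim: n => //= n <-.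
exact: (congr1 (fun f => f (iter n (@shift_map G) x)) Phi_shift).
Qed.

Lemma shift_commuting_zero x (A : min_emitter G) :
  xseq x = finite_seq [::] A -> xseq (Phi x) = (fun=> Phi x 0).
Proof.
move=> ex; apply: shift_map_fixed.
by have /= := shift_commuting_iter 1 x; rewrite (shift_map_zero ex) => <-.
Qed.

Lemma shift_commuting_length : length_nonincreasing Phi.
Proof.
move=> x alpha A beta B ex ePx; rewrite leqNgt; apply/negP => ltab.
have := shift_commuting_zero (iter_shift_size ex).
(* The constant sequence is compared at positions [size beta] and 0: in [Phi x] the former falls in
   the tail of [B], the latter on an edge of [beta]. *)
rewrite shift_commuting_iter => /(congr1 (fun z => is_inl (z (size beta)))).
by rewrite !iter_shiftE ePx !is_inl_finite_seq addn0 ltab ltnNge leq_addl.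
Qed.

Lemma continuous_block_partition : continuous Phi ->
  cylinder_partition (fun a => [set x | Phi x 0 = a]).
Proof.
move=> cPhi; split.
- by move=> a b _ _ [x [/= <- <-]].
- by apply/seteqP; split=> // x _; exists (Phi x 0).
move=> e; apply/union_of_cylindersP => x /= ePx.
have Px i : i < 1 -> is_inl (Phi x i) by case: i => // _; rewrite ePx.
have : nbhs x (Phi @^-1` _) := cPhi x _ (nbhs_prefix Px).
by apply: filterS => y /= /(_ 0 isT) ->.
Qed.

Lemma continuous_finite_to_finite : continuous Phi -> finite_to_finite Phi.
Proof.
move=> cPhi x alpha A beta B ex ePx F fF.
have ez := iter_shift_finite (size beta) ex.
have ePz : xseq (Phi (iter (size beta) (@shift_map G) x)) = finite_seq [::] B.
  by rewrite shift_commuting_iter; exact: iter_shift_size.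
have gF : gen_cylinders (cylinder [::] (sval B) F).
  by exists [::], (sval B), F; split=> //; exact: finite_seqP ePz.
have nF := cylinder_nbhs gF (cylinder_finite_seq F ePz).
have [F' fF' sF'] := nbhs_finite ez (cPhi _ _ nF).
by exists F' => // _ [y /sF' ? <-].
Qed.

Lemma continuous_zero_to_positive : continuous Phi ->
  zero_to_positive Phi (fun a => [set x | Phi x 0 = a]).
Proof.
move=> cPhi x A ex nX0; have cst := shift_commuting_zero ex.
exists (Phi x 0) => // M _.
(* A constant image outside [X0] repeats an edge, so its first [M.+1] letters, those for
   [i = 0, ..., M], are locally constant. *)
have PxE i : i < M.+1 -> is_inl (Phi x i).
  move=> _; rewrite cst; case eP0: (Phi x 0) => [//|B]; case: nX0.
  by exists B; rewrite cst eP0; apply/funext => n; rewrite finite_seq_nil.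
have [F fF sF] := nbhs_finite ex (cPhi x _ (nbhs_prefix PxE)).
exists F => // i leiM _ [y /sF /= yP <-].
by rewrite shift_commuting_iter iter_shiftE addn0 yP // cst.
Qed.

End ShiftCommuting.

(** * The converse: from the block formula to continuity *)

Section BlockFormula.
Context {G H : ultragraph} {Phi : shift_space G -> shift_space H}
  {C : letter H -> set (shift_space G)}.
Hypothesis PhiC : block_formula Phi C.

(** The formula reads letter [n] from the [n]-th shift of [x] alone, so shifting the point and
    shifting its image advance the same index. *)
Lemma block_formula_shift : shift_commuting Phi.
Proof.
apply/funext => x; apply: shift_space_ext; apply/funext => n /=.
by apply/PhiC; rewrite -iterSr; apply/PhiC.
Qed.

Let Phi_iter := shift_commuting_iter block_formula_shift.
Hypotheses (C_part : cylinder_partition C) (Phi_fin : finite_to_finite Phi).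

Lemma block_formula_coord (x : shift_space G) n :
  (forall i, i < n -> is_inl (x i)) ->
  is_inl (Phi x n) -> \forall y \near x, Phi y n = Phi x n.
Proof.
move=> xn; case ePx: (Phi x n) => [e|//] _.
have [_ _ /(_ e) /union_of_cylindersP Ce] := C_part.
move/PhiC/Ce: ePx => /(iter_shift_cvg xn) nC.
by apply: (@filterS _ (nbhs x)) nC => y /PhiC.
Qed.

Lemma block_formula_prefix (x : shift_space G) n :
  (forall i, i < n -> is_inl (x i)) ->
  (forall i, i < n -> is_inl (Phi x i)) ->
  \forall y \near x, forall i, i < n -> Phi y i = Phi x i.
Proof.
elim: n => [|n IHn] xn Pxn; first by apply: filterS filterT.
have xlt i (lt_in : i < n) := xn i (ltnW lt_in).
have nn := block_formula_coord xlt (Pxn n (ltnSn n)).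
have nlt := IHn xlt (fun i lt_in => Pxn i (ltnW lt_in)).
apply: filterS2 nn nlt => y eyn eylt i.
by rewrite ltnS leq_eqVlt => /predU1P[->|/eylt].
Qed.

Hypothesis Phi_inf :
  forall x, (@Xinf G `&` Phi @^-1` @X0 H) x -> {for x, continuous Phi}.

Lemma block_formula_cvg_zero x (B : min_emitter H) :
  xseq (Phi x) = finite_seq [::] B -> Phi @ x --> Phi x.
Proof.
move=> ePx.
case: (finite_or_is_inl x) => [[alpha [A ex]]|/XinfP xinf]; last first.
  by apply: Phi_inf; split=> //; exists B.
move=> U /(nbhs_finite ePx)[F fF FU]; rewrite /fmap /=.
have [F' fF' sF'] := Phi_fin ex ePx fF.
rewrite drop0 in sF'.
have gF' : gen_cylinders (cylinder alpha (sval A) F').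
  by exists alpha, (sval A), F'; split=> //; exact: finite_seqP ex.
apply: filterS (cylinder_nbhs gF' (cylinder_finite_seq F' ex)) => y Fy.
by apply: FU; apply: sF'; exists y.
Qed.

Lemma block_formula_cvg_finite x beta (B : min_emitter H) :
  xseq (Phi x) = finite_seq beta B -> Phi @ x --> Phi x.
Proof.
move=> ePx U /(nbhs_finite ePx)[F fF FU]; rewrite /fmap /=.
(* The image is no longer than [x], so [size beta] shifts stay within the range where the iterated
   shift is continuous at [x]. *)
have xl i : i < size beta -> is_inl (x i).
  case: (finite_or_is_inl x) => [[alpha [A ex]]|xE] lti; last exact: xE.
  rewrite ex is_inl_finite_seq; apply: leq_trans lti _.
  exact: (shift_commuting_length block_formula_shift) ex ePx.
have Pxl i : i < size beta -> is_inl (Phi x i).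
  by rewrite ePx is_inl_finite_seq.
have ePz : xseq (Phi (iter (size beta) (@shift_map G) x)) = finite_seq [::] B.
  by rewrite Phi_iter; exact: iter_shift_size.
have gF : gen_cylinders (cylinder [::] (sval B) F).
  by exists [::], (sval B), F; split=> //; exact: finite_seqP ePz.
have nF := cylinder_nbhs gF (cylinder_finite_seq F ePz).
have : nbhs x (_ @^-1` _) :=
  iter_shift_cvg xl (block_formula_cvg_zero ePz nF).
apply: filterS2 (block_formula_prefix xl Pxl) => y Py Fy.
apply: FU; apply/cylinderE; split; last by rewrite -Phi_iter.
rewrite -(mkseq_finite_seq beta B) -ePx; apply/eq_in_map => i.
by rewrite mem_iota; exact: Py.
Qed.

Hypothesis Phi_pos : zero_to_positive Phi C.

Lemma block_formula_prefix_infinite x n : (forall i, is_inl (Phi x i)) ->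
  \forall y \near x, forall i, i < n -> Phi y i = Phi x i.
Proof.
move=> Px; case: (finite_or_is_inl x) => [[alpha [A ex]]|xE]; last first.
  exact: block_formula_prefix.
have xk i : i < size alpha -> is_inl (x i) by rewrite ex is_inl_finite_seq.
have ez := iter_shift_size ex.
have nX0 : ~ X0 (Phi (iter (size alpha) (@shift_map G) x)).
  rewrite Phi_iter => -[B /(congr1 (fun z => is_inl (z 0)))].
  by rewrite iter_shiftE Px.
(* The bound is [n.+1] because (iii) requires a positive integer and [n] may be 0. *)
have [d ePz /(_ n.+1 isT)[F fF sF]] := Phi_pos ez nX0.
have gF : gen_cylinders (cylinder [::] (sval A) F).
  by exists [::], (sval A), F; split=> //; exact: finite_seqP ez.
have : nbhs x (_ @^-1` _) :=
  iter_shift_cvg xk (cylinder_nbhs gF (cylinder_finite_seq F ez)).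
apply: filterS2 (block_formula_prefix xk (fun i _ => Px i)) => y Py Fy i ltin.
case: (ltnP i (size alpha)) => [/Py //|/subnKC <-].
have le_in : i - size alpha <= n.+1.
  by rewrite (leq_trans (leq_subr _ _)) // ltnW // ltnW.
(* Past position [size alpha], letter [i] of [Phi y] is read from the shift by [i - size alpha] of a
   point of the cylinder, which (iii) places in [C d]. *)
rewrite -!iter_shiftE -!Phi_iter ePz; apply/PhiC.
by apply: (sF _ le_in); exists (iter (size alpha) (@shift_map G) y).
Qed.

Lemma block_formula_continuous : continuous Phi.
Proof.
move=> x; case: (finite_or_is_inl (Phi x)) => [[beta [B ePx]]|Px].
  exact: block_formula_cvg_finite ePx.
move=> U /(nbhs_infinite Px)[n nU].
apply: (@filterS _ (nbhs x)) (block_formula_prefix_infinite n Px) => y.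
exact: nU.
Qed.

End BlockFormula.

Theorem theorem3p19 (G H : ultragraph)
    (G_no_sinks : no_sinks G) (H_no_sinks : no_sinks H)
    (Phi : shift_space G -> shift_space H) :
  (continuous Phi -> shift_commuting Phi ->
     length_nonincreasing Phi /\
     exists C : letter H -> set (shift_space G),
       [/\ block_formula Phi C, cylinder_partition C,
           finite_to_finite Phi & zero_to_positive Phi C]) /\
  ((forall x, (@Xinf G `&` Phi @^-1` @X0 H) x -> {for x, continuous Phi}) ->
   forall C : letter H -> set (shift_space G),
     block_formula Phi C -> cylinder_partition C ->
     finite_to_finite Phi -> zero_to_positive Phi C ->
     continuous Phi /\ shift_commuting Phi).
Proof.
split=> [cPhi Phi_shift|Phi_inf C PhiC C_part Phi_fin Phi_pos].
  split; first exact: shift_commuting_length.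
  exists (fun a => [set x | Phi x 0 = a]); split.
  - move=> x n a.
    by rewrite /= (shift_commuting_iter Phi_shift) iter_shiftE addn0.
  - exact: continuous_block_partition.
  - exact: continuous_finite_to_finite.
  - exact: continuous_zero_to_positive.
split; last exact: block_formula_shift PhiC.
exact: block_formula_continuous.
Qed.
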